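(* Complete Sequence Addition and Complete Sequence Multiplication both satisfy closure: for every finite set $S=\{o_1,\dots,o_n\}$ of $n\ge 2$ OIE instances, every index tuple $(i_1,\dots,i_n)$ of length $n$ and all reals $\alpha<\beta$, both $\oplus|_\alpha^\beta(o_{i_1},\dots,o_{i_n})$ and $\otimes(o_{i_1},\dots,o_{i_n})$ are OIE instances.
   Context: Times are real numbers; a ''2-tuple'' is a pair $(x,y)$ of reals with $x<y$ (starting and ending timestamp). For a nonempty finite tuple of 2-tuples $T=((x_1,y_1),\dots,(x_m,y_m))$ put $\mathrm{bound}(T)=(\min_i x_i,\max_i y_i)$. An OIE (Optional Intervals Event) instance is a 4-tuple $o=(\mathcal C_o,\mathcal F_o,\mathcal I_o,\mathcal A_o)$ where $\mathcal C_o$ is a finite (possibly empty) tuple of OIE instances, $\mathcal F_o$ is a set of nonempty finite tuples of 2-tuples, $\mathcal I_o=\{\mathrm{bound}(T):T\in\mathcal F_o\}$, and $\mathcal A_o$ is a set of (labels of) atomic events. The void instance $o_{\mathrm{void}}=((),\emptyset,\emptyset,\emptyset)$ is an OIE instance; every other instance has $\mathcal F_o,\mathcal I_o,\mathcal A_o$ nonempty. An index tuple of length $n$ is a tuple in which each of $1,\dots,n$ occurs exactly once. A permutation matrix $M$ acts on $n$-tuples (viewed as row vectors) on the right by reordering the entries, $T\mapsto T\cdot M$. For $S=\{o_1,\dots,o_n\}$ and an index tuple $\sigma=(i_1,\dots,i_n)$, let $N(S,\sigma)=\{(t_1,\dots,t_n): t_k\in\mathcal I_{o_{i_k}}\text{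 for all }k\}$. External constraints determine an infeasible subset $\mathrm{Inf}(S,\sigma)\subseteq N(S,\sigma)$; this is given data, subject only to the standing axiom: whenever $\sigma\cdot M=\tau$ for index tuples $\sigma,\tau$ of length $n>1$ and a permutation matrix $M$, the map $T\mapsto T\cdot M$ is a bijection from $\mathrm{Inf}(S,\sigma)$ onto $\mathrm{Inf}(S,\tau)$. Put $\mathrm{Feas}(S,\sigma)=N(S,\sigma)\setminus\mathrm{Inf}(S,\sigma)$. Domain filter: for a nonempty set $X$ of $n$-tuples of 2-tuples and reals $\alpha<\beta$, let $X'=\{T\in X: x\ge\alpha\text{ and }y\le\beta\text{ for every entry }(x,y)\text{ of }T\}$. Then $\mathrm{Dom}_\alpha^\beta(X)=X'$ if for every $k\in\{1,\dots,n\}$ some $T\in X'$ has $k$-th entry with first item $\alpha$ and some $T\in X'$ has $k$-th entry with second item $\beta$; otherwise $\mathrm{Dom}_\alpha^\beta(X)=\emptyset$. Ascending filter: for a set $X$ of tuples of 2-tuples, $\mathrm{Asc}(X)$ is the set of $T\in X$ such that for all positions $p<q$ the second item of the $p$-th entry of $T$ is $\le$ the first item of the $q$-th entry of $T$. Complete Sequence Addition $\oplus|_\alpha^\beta(o_{i_1},\dots,o_{i_n})$ and Complete Sequence Multiplication $\otimes(o_{i_1},\dots,o_{i_n})$, with $\sigma=(i_1,\dots,i_n)$: write $\Phi=\mathrm{Dom}_\alpha^\beta$ for $\oplus|_\alpha^\beta$ and $\Phi=\mathrm{Asc}$ for $\otimes$. The result is $o_{\mathrm{void}}$ if $\bigcap_{k}\mathcal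 A_{o_{i_k}}\ne\emptyset$, or some $o_{i_k}=o_{\mathrm{void}}$, or $\mathrm{Feas}(S,\sigma)=\emptyset$, or $\Phi(\mathrm{Feas}(S,\sigma))=\emptyset$. Otherwise the result is $(\mathcal C,\mathcal F,\mathcal I,\mathcal A)$ with $\mathcal C=(o_{i_1},\dots,o_{i_n})$, $\mathcal F=\Phi(\mathrm{Feas}(S,\sigma))$, $\mathcal I=\{\mathrm{bound}(T):T\in\mathcal F\}$, $\mathcal A=\bigcup_k\mathcal A_{o_{i_k}}$. *)

(* Defs.v *)
From Stdlib Require List.
From mathcomp Require Import all_boot all_order all_algebra all_fingroup.
From mathcomp Require Import all_classical all_reals.

Set Implicit Arguments.
Unset Strict Implicit.
Unset Printing Implicit Defensive.

Import Order.TTheory GRing.Theory Num.Theory.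
Local Open Scope classical_set_scope.
Local Open Scope ring_scope.

Definition two_tuple (R : realType) (t : R * R) : Prop := t.1 < t.2.

(* The value on the empty sequence is junk: [is_oie] excludes it from F. *)
Definition bound (R : realType) (T : seq (R * R)) : R * R :=
  if T is t :: T' then
    (\big[Num.min/t.1]_(s <- T') s.1, \big[Num.max/t.2]_(s <- T') s.2)
  else (0, 0).

(* Arbitrary 4-tuples (C, F, I, A) of the right shape, with atomic events
   labelled in L; the OIE instances among them are singled out by [is_oie]. *)
Inductive oie (R : realType) (L : Type) : Type := Oie {
  oieC : seq (oie R L);
  oieF : set (seq (R * R));
  oieI : set (R * R);
  oieA : set L }.

Definition void_oie (R : realType) (L : Type) : oie R L :=
  Oie [::] set0 set0 set0.

Inductive is_oie (R : realType) (L : Type) (o : oie R L) : Prop :=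
  IsOie of
    (forall c, List.In c (oieC o) -> is_oie c)
  & (forall T, oieF o T ->
       T <> [::] /\ (forall t, t \in T -> two_tuple t))
  & oieI o = [set bound T | T in oieF o]
  & (o = void_oie R L \/
     [/\ oieF o !=set0, oieI o !=set0 & oieA o !=set0]).

(* Indices range over {0, ..., n-1} rather than {1, ..., n}. *)
Definition index_tuple (n : nat) (sigma : n.-tuple 'I_n) : Prop :=
  forall i, count_mem i sigma = 1%N.

(* The right action T . M of the permutation matrix M = perm_mx s on a row of
   arbitrary entries; [act_perm_mx] checks the convention. *)
Definition act_perm (X : Type) (n : nat) (T : n.-tuple X) (s : 'S_n) :
    n.-tuple X :=
  [tuple tnth T ((s^-1)%g j) | j < n].

Lemma act_perm_mx (K : pzRingType) (n : nat) (T : n.-tuple K) (s : 'S_n) :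
  \row_j tnth (act_perm T s) j = (\row_j tnth T j) *m perm_mx s.
Proof.
by rewrite -[s in RHS]invgK -col_permE; apply/rowP=> j; rewrite !mxE tnth_mktuple.
Qed.

(* The set S = {o_1, ..., o_n} is given by its enumeration o. *)
Definition Nset (R : realType) (L : Type) (n : nat) (o : 'I_n -> oie R L)
    (sigma : n.-tuple 'I_n) : set (n.-tuple (R * R)) :=
  [set T | forall k, oieI (o (tnth sigma k)) (tnth T k)].

(* Inf is the infeasibility datum sigma |-> Inf(S, sigma) for the fixed S. *)
Definition inf_axiom (R : realType) (n : nat)
    (Inf : n.-tuple 'I_n -> set (n.-tuple (R * R))) : Prop :=
  forall (sigma tau : n.-tuple 'I_n) (s : 'S_n),
    index_tuple sigma -> index_tuple tau -> act_perm sigma s = tau ->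
    set_bij (Inf sigma) (Inf tau) (fun T => act_perm T s).

Definition Feas (R : realType) (L : Type) (n : nat) (o : 'I_n -> oie R L)
    (Inf : n.-tuple 'I_n -> set (n.-tuple (R * R)))
    (sigma : n.-tuple 'I_n) : set (n.-tuple (R * R)) :=
  Nset o sigma `\` Inf sigma.

Definition in_domain (R : realType) (n : nat) (alpha beta : R)
    (X : set (n.-tuple (R * R))) : set (n.-tuple (R * R)) :=
  [set T | X T /\
     forall k, alpha <= (tnth T k).1 /\ (tnth T k).2 <= beta].

Definition Dom (R : realType) (n : nat) (alpha beta : R)
    (X : set (n.-tuple (R * R))) : set (n.-tuple (R * R)) :=
  let X' := in_domain alpha beta X in
  if `[< forall k : 'I_n,
           (exists2 T, X' T & (tnth T k).1 = alpha) /\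
           (exists2 T, X' T & (tnth T k).2 = beta) >]
  then X' else set0.

Definition Asc (R : realType) (n : nat)
    (X : set (n.-tuple (R * R))) : set (n.-tuple (R * R)) :=
  [set T | X T /\
     forall p q : 'I_n, (p < q)%N -> (tnth T p).2 <= (tnth T q).1].

Definition complete_op (R : realType) (L : Type) (n : nat)
    (Phi : set (n.-tuple (R * R)) -> set (n.-tuple (R * R)))
    (o : 'I_n -> oie R L)
    (Inf : n.-tuple 'I_n -> set (n.-tuple (R * R)))
    (sigma : n.-tuple 'I_n) : oie R L :=
  let X := Feas o Inf sigma in
  let F := [set tval T | T in Phi X] in
  if `[< [\/ \bigcap_k oieA (o (tnth sigma k)) !=set0,
             exists k, o (tnth sigma k) = void_oie R L,
             X = set0 |
             Phi X = set0] >]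
  then void_oie R L
  else Oie [seq o i | i <- sigma] F [set bound T | T in F]
           (\bigcup_k oieA (o (tnth sigma k))).

Definition complete_seq_add (R : realType) (L : Type) (n : nat)
    (alpha beta : R) (o : 'I_n -> oie R L)
    (Inf : n.-tuple 'I_n -> set (n.-tuple (R * R)))
    (sigma : n.-tuple 'I_n) : oie R L :=
  complete_op (Dom alpha beta) o Inf sigma.

Definition complete_seq_mul (R : realType) (L : Type) (n : nat)
    (o : 'I_n -> oie R L)
    (Inf : n.-tuple 'I_n -> set (n.-tuple (R * R)))
    (sigma : n.-tuple 'I_n) : oie R L :=
  complete_op (@Asc R n) o Inf sigma.

(* Main.v *)
Require Import Defs.
From mathcomp Require Import all_boot all_order all_algebra all_fingroup.
From mathcomp Require Import all_classical all_reals.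

Import Order.TTheory GRing.Theory Num.Theory.
Local Open Scope classical_set_scope.
Local Open Scope ring_scope.

(** Addition and multiplication are both [complete_op] for a filter [Phi] that
    only discards tuples, and this alone gives closure ([complete_op_is_oie]).
    In the non-void case the entries of a surviving tuple lie in the interval
    sets of the operands, and each such interval is a genuine 2-tuple: it is
    the [bound] of a nonempty tuple of 2-tuples, whose smallest start and
    largest end are separated by any one of its entries ([two_tuple_bound]).
    Its three sets are nonempty, because an empty [Phi (Feas o Inf sigma)] or a
    void operand would have sent the operation to the void instance. *)

Lemma two_tuple_bound (R : realType) (T : seq (R * R)) :
  T <> [::] -> (forall t, t \in T -> two_tuple t) -> two_tuple (bound T).
Proof.
case: T => // t T _ /(_ t (mem_head t T)) ht; rewrite /two_tuple /=.
exact: le_lt_trans (bigmin_le_id _ _ _ _) (lt_le_trans ht (bigmax_ge_id _ _ _ _)).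
Qed.

Lemma oieI_two_tuple (R : realType) (L : Type) (o : oie R L) (t : R * R) :
  is_oie o -> oieI o t -> two_tuple t.
Proof.
case=> _ hF -> _ [T /hF[T0 hT] <-]; exact: two_tuple_bound.
Qed.

Lemma Nset_two_tuple (R : realType) (L : Type) (n : nat) (o : 'I_n -> oie R L)
    (sigma : n.-tuple 'I_n) (T : n.-tuple (R * R)) :
  (forall i, is_oie (o i)) -> Nset o sigma T ->
  forall t, t \in T -> two_tuple t.
Proof.
by move=> ho NT _ /tnthP[k ->]; exact: oieI_two_tuple (ho _) (NT k).
Qed.

Lemma void_oie_is_oie (R : realType) (L : Type) : is_oie (void_oie R L).
Proof.
by split=> //=; [rewrite image_set0 | left].
Qed.

(** Positivity of [n] enters twice: it makes the surviving [n]-tuples nonempty,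
    and it provides an operand from which the result inherits an atomic event. *)
Lemma complete_op_is_oie (R : realType) (L : Type) (n : nat)
    (Phi : set (n.-tuple (R * R)) -> set (n.-tuple (R * R)))
    (o : 'I_n -> oie R L) (Inf : n.-tuple 'I_n -> set (n.-tuple (R * R)))
    (sigma : n.-tuple 'I_n) :
  (0 < n)%N -> (forall X, Phi X `<=` X) -> (forall i, is_oie (o i)) ->
  is_oie (complete_op Phi o Inf sigma).
Proof.
move=> n_gt0 subPhi ho; rewrite /complete_op.
case: asboolP => [_|nondeg]; first exact: void_oie_is_oie.
have /set0P[T PhiT] : Phi (Feas o Inf sigma) != set0.
  by apply/eqP => Phi0; apply: nondeg; exact: Or44.
apply: IsOie.
- by move=> c /List.in_map_iff[i [<- _]]; exact: ho.
- move=> _ [U /subPhi[NU _] <-]; split; last exact: (Nset_two_tuple _ _ _ _ sigma).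
  by move=> U0; move: n_gt0; rewrite -(size_tuple U) U0.
- by [].
- right; split.
  + by exists T; exists T.
  + by exists (bound T), T => //; exists T.
  + pose k := Ordinal n_gt0.
    case: (ho (tnth sigma k)) => _ _ _ [void_k|[_ _ [a Aa]]].
      by case: nondeg; apply: Or42; exists k.
    by exists a, k.
Qed.

Lemma Dom_subset (R : realType) (n : nat) (alpha beta : R)
    (X : set (n.-tuple (R * R))) :
  Dom alpha beta X `<=` X.
Proof. by rewrite /Dom; case: asboolP => _ T // []. Qed.

Lemma Asc_subset (R : realType) (n : nat) (X : set (n.-tuple (R * R))) :
  Asc X `<=` X.
Proof. by move=> T []. Qed.

Theorem mainTheorem4 (R : realType) (L : Type) (n : nat) (hn : (2 <= n)%N)
    (o : 'I_n -> oie R L) (ho : forall i, is_oie (o i))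
    (Inf : n.-tuple 'I_n -> set (n.-tuple (R * R)))
    (hInf_sub : forall sigma, index_tuple sigma ->
       Inf sigma `<=` Nset o sigma)
    (hInf_perm : inf_axiom Inf)
    (sigma : n.-tuple 'I_n) (hsigma : index_tuple sigma)
    (alpha beta : R) (hab : alpha < beta) :
  is_oie (complete_seq_add alpha beta o Inf sigma) /\
  is_oie (complete_seq_mul o Inf sigma).
Proof.
have n_gt0 : (0 < n)%N := ltnW hn.
split; apply: complete_op_is_oie => // X; [exact: Dom_subset | exact: Asc_subset].
Qed.
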